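(* Let $\alpha>-1$ and $\gamma_n=n$ for $n\ge1$. Then: (i) For all $j\ge2$, $$(2+\gamma_j-\gamma_{j+1})+\frac{1}{\gamma_{j-1}}(j-1)(j+\alpha)-\frac{1}{\gamma_j}\,j(j+\alpha+1)=0 .$$ (ii) For all $n\ge1$ the quasi-Christoffel Laguerre polynomial $$L^{QC}_n(x;0)=\mathcal L^{(\alpha+1)}_n(x)+n\,\mathcal L^{(\alpha+1)}_{n-1}(x)$$ equals $\mathcal L^{(\alpha)}_n(x)$. (iii) With $L^{QC}_0(x;0)=1$, the polynomials $L^{QC}_n(x;0)$, $n\ge0$, are orthogonal with respect to $d\mu=x^{\alpha}e^{-x}\,dx$ on $(0,\infty)$, and for all $n\ge1$ $$L^{QC}_{n+1}(x;0)=(x-c^{qc}_{n+1})L^{QC}_n(x;0)-\lambda^{qc}_{n+1}L^{QC}_{n-1}(x;0),\qquad \lambda^{qc}_{n+1}=n(n+\alpha),\quad c^{qc}_{n+1}=2n+\alpha+1 .$$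
   Context: For $a>-1$, $\mathcal L^{(a)}_n(x)$ denotes the monic Laguerre polynomial of degree $n$, defined by $\mathcal L^{(a)}_{-1}=0$, $\mathcal L^{(a)}_0=1$ and $$\mathcal L^{(a)}_{n+1}(x)=(x-(2n+a+1))\mathcal L^{(a)}_n(x)-n(n+a)\mathcal L^{(a)}_{n-1}(x),\quad n\ge0;$$ these are orthogonal on $(0,\infty)$ with respect to $x^ae^{-x}$. A family of polynomials $(p_n)_{n\ge n_0}$ is orthogonal with respect to a measure $\mu$ if $\int p_np_m\,d\mu$ converges absolutely for all $n,m\ge n_0$, is $0$ for $n\ne m$ and is nonzero for $n=m$. *)

(* Defs.v *)
From HB Require Import structures.
From mathcomp Require Import all_boot all_order all_algebra.
From mathcomp Require Import all_classical all_reals all_analysis.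
From mathcomp Require Import measurable_realfun.

Set Implicit Arguments.
Unset Strict Implicit.
Unset Printing Implicit Defensive.

Import Order.TTheory GRing.Theory Num.Theory.
Import numFieldNormedType.Exports.

Local Open Scope classical_set_scope.
Local Open Scope ring_scope.

(* Monic Laguerre polynomials; the inner [else 0] is the convention that the
   polynomial of index -1 vanishes. *)
Fixpoint laguerre (R : realType) (a : R) (n : nat) : {poly R} :=
  if n is k.+1 then
    ('X - (2 * k%:R + a + 1)%:P) * laguerre a k
      - (k%:R * (k%:R + a)) *: (if k is l.+1 then laguerre a l else 0)
  else 1.

(* L^{QC}_n(x; 0) for the parameters gamma_n = n. *)
Definition qc_laguerre (R : realType) (alpha : R) (n : nat) : {poly R} :=
  if n is k.+1 then
    laguerre (alpha + 1) k.+1 + k.+1%:R *: laguerre (alpha + 1) k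
  else 1.

(* Only the members of index [>= n0] belong to the family; [integrable] is the
   absolute convergence of the integral. *)
Definition orthogonal_polys (R : realType) (n0 : nat) (p : nat -> {poly R})
    (mu : {measure set (measurableTypeR R) -> \bar R}) : Prop :=
  forall n m : nat, (n0 <= n)%N -> (n0 <= m)%N ->
    [/\ mu.-integrable [set: R] (fun x : R => ((p n).[x] * (p m).[x])%:E),
        n <> m -> (\int[mu]_x ((p n).[x] * (p m).[x])%:E = 0)%E
      & n = m -> (\int[mu]_x ((p n).[x] * (p m).[x])%:E <> 0)%E].

Definition laguerre_weight (R : realType) (a : R) : R -> R :=
  (fun x => x `^ a * expR (- x)) \_ `]0, +oo[.

Definition laguerre_measure (R : realType) (a : R) :
    set (measurableTypeR R) -> \bar R :=
  fun A => (\int[lebesgue_measure]_(x in A) (laguerre_weight a x)%:E)%E.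

Section laguerre_measure.
Context {R : realType} (a : R).

Lemma laguerre_weight_ge0 (x : R) : 0 <= laguerre_weight a x.
Proof.
by apply: restrict_ge0 => y _; rewrite mulr_ge0 ?powR_ge0 ?expR_ge0.
Qed.

Lemma measurable_laguerre_weight :
  measurable_fun [set: R] (laguerre_weight a).
Proof.
apply/measurable_restrict => //; apply: measurable_funTS.
apply: measurable_funM; first exact: measurable_powR.
by apply: measurableT_comp.
Qed.

Let laguerre_measure0 : laguerre_measure a set0 = 0%E.
Proof. exact: integral_set0. Qed.

Let laguerre_measure_ge0 A : (0 <= laguerre_measure a A)%E.
Proof. by apply: integral_ge0 => x _; rewrite lee_fin laguerre_weight_ge0. Qed.

Let laguerre_measure_sigma_additive :
  semi_sigma_additive (laguerre_measure a).
Proof.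
apply: semi_sigma_additive_nng_induced.
- by apply/measurable_EFinP; exact: measurable_laguerre_weight.
- by move=> x; rewrite lee_fin laguerre_weight_ge0.
Qed.

HB.instance Definition _ := isMeasure.Build _ _ _ (laguerre_measure a)
  laguerre_measure0 laguerre_measure_ge0 laguerre_measure_sigma_additive.

End laguerre_measure.

(* Main.v *)
Require Import Defs.
From HB Require Import structures.
From mathcomp Require Import all_boot all_order all_algebra.
From mathcomp Require Import all_classical all_reals all_analysis.
From mathcomp Require Import measurable_realfun.
From mathcomp Require Import ring lra.

(** Adding one step of the Laguerre family of parameter [a + 1] with
coefficient [n] lowers the parameter by one:
[laguerre a n = laguerre (a + 1) n + n *: laguerre (a + 1) n.-1]
([laguerre_parameter_shift]). So the quasi-Christoffel polynomials with
[gamma_n = n] are the Laguerre polynomials of parameter [alpha], and their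
recurrence is the defining one. The identity between the [gamma_j] is a
computation in a field.

Orthogonality rests on two facts about the functional
[L p = \int p(x) x^a e^{-x} dx] over the positive half-line. Integration by
parts gives the Pearson equation [L (x q') = L ((x - a - 1) q)]
([pearson_equation]), which needs only the ratio [k + a + 1] of consecutive
moments, that is, the functional equation of the Gamma integral
([gamma_integralD1]). The polynomials have the structure relation
[x L_n' = n L_n + n (n + a) L_{n-1}] ([mulX_deriv_laguerre]). With
[q = L_n L_m] the two combine into the closed recursion
[L (L_{n+1} L_m) = (m - n) L (L_n L_m) + m (m + a) L (L_n L_{m-1})], from which
an induction on [n] reads off both the vanishing for [m < n] and the value
[L (L_n^2) = L 1 * \prod_(k < n) (k + 1) (k + 1 + a)], positive as [a > -1].

On the analytic side, the measure is given by a density with respect to the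
Lebesgue measure, so that its integrals are Lebesgue integrals against the
weight. The Gamma integral is improper at both ends when [a < 0]; it is
treated as a monotone limit of integrals over [[1/(n+2), n+2]], so that its
functional equation holds in the extended reals before finiteness is known,
and finiteness descends from [b + 1] to [b]. *)

Set Implicit Arguments.
Unset Strict Implicit.
Unset Printing Implicit Defensive.

Import Order.TTheory GRing.Theory Num.Theory.
Import numFieldNormedType.Exports.

Local Open Scope classical_set_scope.
Local Open Scope ring_scope.

(** * Algebra of the Laguerre polynomials *)

Section laguerre_algebra.
Context {R : realType}.
Implicit Types (a : R) (n m : nat).

Lemma laguerre0 a : laguerre a 0 = 1. Proof. by []. Qed.

Lemma laguerre1 a : laguerre a 1 = 'X - (a + 1)%:P.
Proof. by rewrite /laguerre !mul0r scale0r subr0 mulr1 mulr0 add0r. Qed.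

Lemma laguerre_rec a n : laguerre a n.+2 =
  ('X - (2 * n.+1%:R + a + 1)%:P) * laguerre a n.+1
    - (n.+1%:R * (n.+1%:R + a)) *: laguerre a n.
Proof. by []. Qed.

(* Keeps rewriting from unfolding the recurrence when it matches products. *)
Local Opaque laguerre.

(** The recurrence solved for ['X * laguerre a n]; in this form it also holds for
[n = 0]: the last coefficient vanishes there, whatever the value at [n.-1]. *)
Lemma laguerre_mulX a n :
  'X * laguerre a n = laguerre a n.+1 + (2 * n%:R + a + 1) *: laguerre a n
    + (n%:R * (n%:R + a)) *: laguerre a n.-1.
Proof.
case: n => [|n].
  by rewrite laguerre1 laguerre0 !mul0r scale0r mulr0 add0r alg_polyC mulr1 addr0 subrK.
by rewrite laguerre_rec -!mul_polyC /=; ring.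
Qed.

(** The right-hand side satisfies the recurrence of parameter [a]: the term
[laguerre (a + 1) n.-2] is eliminated by the recurrence of parameter [a + 1]. *)
Lemma laguerre_parameter_shift a n :
  laguerre a n = laguerre (a + 1) n + n%:R *: laguerre (a + 1) n.-1.
Proof.
elim/ltn_ind: n => -[_|[_|[|n] IH]].
- by rewrite scale0r addr0.
- by rewrite !laguerre1 laguerre0 scale1r; ring.
- rewrite !laguerre_rec !laguerre1 !laguerre0 -!mul_polyC; ring.
rewrite laguerre_rec (IH n.+2)// (IH n.+1)// /= (laguerre_rec (a + 1) n.+1).
rewrite (laguerre_rec (a + 1) n) -!mul_polyC.
ring.
Qed.

(** Structure relation. Differentiating the recurrence expresses the left-hand
side by the relations of the two lower degrees, after which the recurrence
eliminates [laguerre a n.-2]. *)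
Lemma mulX_deriv_laguerre a n :
  'X * (laguerre a n)^`() =
    n%:R *: laguerre a n + (n%:R * (n%:R + a)) *: laguerre a n.-1.
Proof.
elim/ltn_ind: n => -[_|[_|[|n] IH]].
- by rewrite derivC !mul0r !scale0r mulr0 addr0.
- by rewrite laguerre1 laguerre0 derivB derivX derivC -!mul_polyC; ring.
- rewrite laguerre_rec laguerre1 laguerre0 -!mul_polyC.
  rewrite !(derivB, derivM, derivX, derivC) /=; ring.
rewrite laguerre_rec derivB derivZ derivM derivB derivX derivC subr0 mul1r.
rewrite mulrBr mulrDr mulrCA (IH n.+2)// -scalerAr (IH n.+1)// /=.
rewrite (laguerre_rec a n) -!mul_polyC.
ring.
Qed.

Section moment_functional.
Variables (a : R) (Lam : {scalar {poly R}}).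
Hypothesis Lam_momentS :
  forall k, Lam 'X^(k.+1) = (k%:R + a + 1) * Lam 'X^k.

(** Algebraic form of the integration by parts of [(q x^(a+1) e^{-x})']: by
linearity it is enough to know it on monomials, where it is the ratio of
consecutive moments. *)
Lemma pearson_equation q : Lam ('X * q^`()) = Lam (('X - (a + 1)%:P) * q).
Proof.
rewrite -[q]coefK poly_def raddf_sum /= !mulr_sumr !raddf_sum.
apply: eq_bigr => i _ /=.
rewrite derivZ derivXn -!scalerAr !linearZ /=; congr (_ * _).
rewrite mulrBl mul_polyC linearB linearZ /= -exprS Lam_momentS mulrnAr raddfMn.
case: (nat_of_ord i) => [|k]; first by rewrite mulr0n add0r subrr.
by rewrite -exprS /= -mulr_natl; ring.
Qed.

(** The Pearson equation for [q = laguerre a n * laguerre a m], with the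
derivatives removed by the structure relation and the multiplication by ['X]
by the recurrence; the two terms in [laguerre a n.-1 * laguerre a m] cancel. *)
Lemma moment_laguerre_rec n m :
  Lam (laguerre a n.+1 * laguerre a m) =
    (m%:R - n%:R) * Lam (laguerre a n * laguerre a m) +
    m%:R * (m%:R + a) * Lam (laguerre a n * laguerre a m.-1).
Proof.
have dE : 'X * (laguerre a n * laguerre a m)^`() =
    (n%:R + m%:R) *: (laguerre a n * laguerre a m)
    + (n%:R * (n%:R + a)) *: (laguerre a n.-1 * laguerre a m)
    + (m%:R * (m%:R + a)) *: (laguerre a n * laguerre a m.-1).
  rewrite derivM mulrDr mulrA mulX_deriv_laguerre mulrCA mulX_deriv_laguerre.
  by rewrite -!mul_polyC; ring.
have mE : ('X - (a + 1)%:P) * (laguerre a n * laguerre a m) =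
    laguerre a n.+1 * laguerre a m
    + (2 * n%:R) *: (laguerre a n * laguerre a m)
    + (n%:R * (n%:R + a)) *: (laguerre a n.-1 * laguerre a m).
  rewrite mulrBl mulrA laguerre_mulX -!mul_polyC.
  by move: (laguerre a n.+1) => p; ring.
have := pearson_equation (laguerre a n * laguerre a m).
rewrite dE mE !linearD !linearZ /=; lra.
Qed.

Lemma moment_laguerre_lt n m : (m < n)%N -> Lam (laguerre a n * laguerre a m) = 0.
Proof.
elim: n m => // n IH m; rewrite ltnS leq_eqVlt => /predU1P[->|mn].
  rewrite moment_laguerre_rec subrr mul0r add0r.
  by case: n IH => [|n] IH; rewrite ?mul0r// IH ?mulr0.
rewrite moment_laguerre_rec !IH ?mulr0 ?addr0//.
exact: leq_ltn_trans (leq_pred m) mn.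
Qed.

(** The recursion at [m = n + 1] leaves only the square of the lower degree, as
[laguerre a n * laguerre a n.+1] has moment zero. *)
Lemma moment_laguerre_sqr n :
  Lam (laguerre a n * laguerre a n) =
    Lam 1 * \prod_(k < n) (k.+1%:R * (k.+1%:R + a)).
Proof.
elim: n => [|n IH]; first by rewrite big_ord0 !mulr1.
rewrite moment_laguerre_rec [laguerre a n * laguerre a n.+1]mulrC.
rewrite (@moment_laguerre_lt n.+1 n)// mulr0 add0r big_ord_recr /= IH; ring.
Qed.

End moment_functional.
End laguerre_algebra.

(** * Integration against a density *)

Section density.
Local Open Scope ereal_scope.
Context d (T : measurableType d) (R : realType).
Variables (nu : {finite_measure set T -> \bar R})
          (mu : {sigma_finite_measure set T -> \bar R}) (w : T -> \bar R).
Hypothesis iw : mu.-integrable [set: T] w.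
Hypothesis nuE : forall A, measurable A -> nu A = \int[mu]_(x in A) w x.

Lemma density_dominates : nu `<< mu.
Proof.
apply/null_content_dominatesP => A mA muA; rewrite nuE//.
apply: null_set_integral => //.
by apply: measurable_funS (measurable_int _ iw).
Qed.

(** Uniqueness of the Radon-Nikodym derivative. It transfers the change of
variables known for the derivative to any density of [nu]. *)
Lemma density_Radon_Nikodym :
  ae_eq mu [set: T] (Radon_Nikodym_SigmaFinite.f nu mu) w.
Proof.
apply: integral_ae_eq => //.
- exact: Radon_Nikodym_SigmaFinite.f_integrable density_dominates.
- exact: measurable_int iw.
- move=> A _ mA.
  by rewrite -nuE// -Radon_Nikodym_SigmaFinite.f_integral//; exact: density_dominates.
Qed.

Lemma ge0_integral_density f : (forall x, 0 <= f x) ->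
  measurable_fun [set: T] f -> \int[nu]_x f x = \int[mu]_x (f x * w x).
Proof.
move=> f0 mf.
rewrite -(Radon_Nikodym_SigmaFinite.change_of_variables density_dominates)//.
apply: ae_eq_integral => //.
- apply: emeasurable_funM => //.
  exact: measurable_int (Radon_Nikodym_SigmaFinite.f_integrable density_dominates).
- by apply: emeasurable_funM => //; exact: measurable_int iw.
- by apply: ae_eqe_mul2l; exact: density_Radon_Nikodym.
Qed.

Hypothesis w0 : forall x, 0 <= w x.

Lemma integrable_density f : measurable_fun [set: T] f ->
  mu.-integrable [set: T] (f \* w) -> nu.-integrable [set: T] f.
Proof.
move=> mf /integrableP[_]; under eq_integral do rewrite abseM (gee0_abs (w0 _)).
move=> fw; apply/integrableP; split => //.
by rewrite ge0_integral_density//; exact: measurableT_comp.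
Qed.

Lemma integral_density f : nu.-integrable [set: T] f ->
  \int[nu]_x f x = \int[mu]_x (f x * w x).
Proof.
move=> fi; have mf := measurable_int _ fi.
rewrite -(Radon_Nikodym_change_of_variables density_dominates)//.
apply: ae_eq_integral => //.
- apply: emeasurable_funM => //.
  by apply: measurable_int; apply: Radon_Nikodym_integrable; exact: density_dominates.
- by apply: emeasurable_funM => //; exact: measurable_int iw.
- apply: ae_eqe_mul2l; apply: ae_eq_trans density_Radon_Nikodym.
  apply: ae_eq_sym; apply: ae_eq_Radon_Nikodym_SigmaFinite => //.
  exact: density_dominates.
Qed.
End density.

(** * The Gamma integral *)

Section gamma_integral.
Context {R : realType}.
Local Notation mu := (@lebesgue_measure R).
Implicit Types b x : R.

(** The integrand of Euler's integral for the Gamma function at [b]. *)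
Definition gamma_integrand b x := x `^ (b - 1) * expR (- x).

(** Extended-real valued, so that the functional equation below can be stated
and proved before convergence is known. *)
Definition gamma_integral b : \bar R :=
  (\int[mu]_(x in `]0%R, +oo[) (gamma_integrand b x)%:E)%E.

Lemma gamma_integrand_ge0 b x : 0 <= gamma_integrand b x.
Proof. by rewrite mulr_ge0 ?powR_ge0 ?expR_ge0. Qed.

Lemma measurable_gamma_integrand b : measurable_fun [set: R] (gamma_integrand b).
Proof.
by apply: measurable_funM; [exact: measurable_powR|exact: measurableT_comp].
Qed.

Lemma is_derive_gamma_integrand b x : 0 < x ->
  is_derive x 1 (gamma_integrand (b + 1))
    (b * gamma_integrand b x - gamma_integrand (b + 1) x).
Proof.
move=> x0; rewrite /gamma_integrand addrK.
have dE : is_derive x 1 (fun y => expR (- y)) (- expR (- x)).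
  rewrite -[X in is_derive _ _ _ X]mulrN1.
  by apply: (is_derive1_comp (f := expR) (g := fun y : R => - y)).
have dP := is_derive1_powR b x0.
have /is_derive_eq := is_deriveM dP dE; apply.
rewrite /GRing.scale/=; ring.
Qed.

Lemma gamma_integrand_continuous b x : 0 < x ->
  {for x, continuous (gamma_integrand b)}.
Proof.
move=> x0; rewrite -(subrK 1 b).
apply: differentiable_continuous; apply/derivable1_diffP.
by have [] := is_derive_gamma_integrand (b - 1) x0.
Qed.

Lemma gamma_integrand_within b (c d : R) : 0 < c ->
  {within `[c, d], continuous (gamma_integrand b)}.
Proof.
move=> c0; apply: continuous_in_subspaceT => x; rewrite inE/= in_itv/= => /andP[cx _].
by apply: gamma_integrand_continuous; exact: lt_le_trans cx.
Qed.

(** With [y = x / (2 b)] the claim is [(y e^{-y})^b <= 1], which follows from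
[y <= e^y]. The factor [e^{-x/2}] left over is both integrable and
infinitesimal at infinity. *)
Lemma gamma_integrand_le b x : 0 < b -> 0 < x ->
  gamma_integrand (b + 1) x <= (2 * b) `^ b * expR (- (x / 2)).
Proof.
move=> b0 x0; rewrite /gamma_integrand addrK.
have b2 : 0 < 2 * b by rewrite mulr_gt0.
have y0 : 0 < x / (2 * b) by rewrite divr_gt0.
have -> : x `^ b = (2 * b) `^ b * (x / (2 * b)) `^ b.
  by rewrite -powRM ?(ltW b2, ltW y0)// [2 * b * _]mulrC divfK// gt_eqF.
rewrite -mulrA ler_wpM2l ?powR_ge0//.
have -> : - x = - (x / 2) + - (x / 2) by lra.
rewrite expRD mulrA ler_piMl ?expR_ge0//.
have -> : expR (- (x / 2)) = (expR (- (x / (2 * b)))) `^ b.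
  rewrite -expRM; congr expR; field; exact/lt0r_neq0.
rewrite -powRM ?expR_ge0 ?(ltW y0)// -[leRHS](_ : 1 `^ b = 1); last by rewrite powR1.
apply: ge0_ler_powR; rewrite ?nnegrE ?(ltW b0)//.
  by rewrite mulr_ge0 ?expR_ge0 ?(ltW y0).
rewrite expRN ler_pdivrMr ?expR_gt0// mul1r.
by apply: le_trans (expR_ge1Dx _); rewrite lerDr.
Qed.

(** Above [1] the integrand is bounded near [0], and the bound
[gamma_integrand_le] is a multiple of the exponential density of rate [1/2]. *)
Lemma gamma_integral_gt1_lty b : 0 < b -> (gamma_integral (b + 1) < +oo)%E.
Proof.
move=> b0; apply: integrable_lty => //.
have half0 : 0 < 2^-1 :> R by rewrite invr_gt0.
have ie := integrableZl measurableT (2 * (2 * b) `^ b) (integrable_exponential_pdf half0).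
apply: le_integrable (integrableS measurableT _ (@subsetT _ _) ie) => //.
- by apply/measurable_funTS/measurable_EFinP; exact: measurable_gamma_integrand.
- move=> x /=; rewrite in_itv/= andbT => x0.
  rewrite lee_fin !ger0_norm ?gamma_integrand_ge0//; last first.
    by rewrite !mulr_ge0 ?powR_ge0// exponential_pdf_ge0.
  apply: le_trans (gamma_integrand_le b0 x0) _.
  rewrite exponential_pdfE ?(ltW x0)//.
  by rewrite mulrACA mulfV// mul1r mulNr [_^-1 * x]mulrC.
Qed.

Lemma gamma_integrand_cvgy b : 0 < b ->
  gamma_integrand (b + 1) x @[x --> +oo] --> 0.
Proof.
move=> b0.
have e0 : (2 * b) `^ b * expR (- (x / 2)) @[x --> +oo] --> 0.
  rewrite -[X in _ --> X](mulr0 ((2 * b) `^ b)); apply: cvgMr.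
  apply: (@cvg_comp _ _ _ (fun x : R => x / 2) (fun y => expR (- y)) _ (pinfty_nbhs R)).
    by apply: gt0_cvgMly => //; rewrite invr_gt0.
  exact: cvgr_expR.
apply: (squeeze_cvgr _ (cvg_cst 0) e0).
by near=> x; rewrite gamma_integrand_ge0 gamma_integrand_le//.
Unshelve. end_near. Qed.

Lemma gamma_integrand_cvg0 b : 0 < b ->
  gamma_integrand (b + 1) x @[x --> 0^'+] --> 0.
Proof.
move=> b0; apply: (squeeze_cvgr _ (cvg_cst 0) (powR_cvg0 b0)).
near=> x; rewrite gamma_integrand_ge0 /gamma_integrand addrK.
rewrite ler_piMr ?powR_ge0// -expR0 ler_expR oppr_le0.
by near: x; exact: nbhs_right_ge.
Unshelve. end_near. Qed.

(** The exhaustion starts at [2] so that every interval has nonempty interior. *)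
Lemma bigcup_itv_inv_nat :
  `]0, +oo[%classic = \bigcup_n `[n.+2%:R^-1, n.+2%:R]%classic :> set R.
Proof.
apply/seteqP; split => x /=; rewrite ?in_itv/= ?andbT.
  move=> x0; exists (Num.truncn (Num.max x x^-1)) => //=.
  have := truncnS_gt (Num.max x x^-1).
  rewrite gt_max => /andP[xn nx]; rewrite in_itv/=.
  set n := Num.truncn _ in xn nx *.
  have n2 : n.+1%:R <= n.+2%:R :> R by rewrite ler_nat.
  rewrite (le_trans (ltW xn) n2) andbT.
  by rewrite invf_ple ?posrE// (le_trans (ltW nx)).
by move=> [n _]; rewrite /= in_itv/= => /andP[+ _]; apply: lt_le_trans.
Qed.

Lemma gamma_integral_cvg b :
  (\int[mu]_(x in `[(n.+2%:R^-1)%R, (n.+2%:R)%R]) (gamma_integrand b x)%:E)%E @[n --> \oo]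
    --> gamma_integral b.
Proof.
rewrite /gamma_integral bigcup_itv_inv_nat.
apply: ge0_nondecreasing_set_cvg_integral => //.
- apply/nondecreasing_seqP => n; rewrite subsetEset.
  apply: subset_itv; rewrite bnd_simp ?ler_nat//.
  by rewrite lef_pV2 ?posrE// ler_nat.
- by move=> n; apply/measurable_funTS/measurable_EFinP; exact: measurable_gamma_integrand.
- by move=> n x _; rewrite lee_fin gamma_integrand_ge0.
Qed.

Lemma gamma_integral_by_parts b (c d : R) : 0 < c -> c < d ->
  (b%:E * \int[mu]_(x in `[c, d]) (gamma_integrand b x)%:E =
   \int[mu]_(x in `[c, d]) (gamma_integrand (b + 1) x)%:E +
   (gamma_integrand (b + 1) d - gamma_integrand (b + 1) c)%:E)%E.
Proof.
move=> c0 cd.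
have gi e : mu.-integrable `[c, d] (EFin \o gamma_integrand e).
  apply: continuous_compact_integrable; first exact: segment_compact.
  exact: gamma_integrand_within.
have F'E x : c <= x -> is_derive x 1 (gamma_integrand (b + 1))
    (b * gamma_integrand b x - gamma_integrand (b + 1) x).
  by move=> cx; apply: is_derive_gamma_integrand; exact: lt_le_trans cx.
have FTC := @continuous_FTC2 R
  (fun x => b * gamma_integrand b x - gamma_integrand (b + 1) x)
  (gamma_integrand (b + 1)) c d cd.
rewrite EFinB -FTC.
- under [X in _ = (_ + X)%E]eq_integral do rewrite EFinB EFinM.
  rewrite integralB//; last 2 first.
    by apply: integrableZl => //; exact: gi.
    exact: gi.
  rewrite integralZl//; last exact: gi.
  rewrite [RHS]addeC subeK//.
  by apply: integrable_fin_num => //; exact: gi.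
- move=> x; apply: cvgB; last exact: gamma_integrand_within.
  by apply: cvgMr; exact: gamma_integrand_within.
- split.
  + move=> x; rewrite in_itv/= => /andP[cx _].
    by have [] := F'E _ (ltW cx).
  + apply: cvg_at_right_filter; exact: gamma_integrand_continuous.
  + apply: cvg_at_left_filter; apply: gamma_integrand_continuous.
    exact: lt_trans cd.
- move=> x; rewrite in_itv/= => /andP[cx _].
  by rewrite derive1E; have [_ ->] := F'E _ (ltW cx).
Qed.

(** Integration by parts over the compact intervals [[1/(n+2), n+2]], whose
boundary terms tend to [0] at both ends since [b > 0]. *)
Lemma gamma_integralD1 b : 0 < b ->
  (gamma_integral (b + 1) = b%:E * gamma_integral b)%E.
Proof.
move=> b0.
have natS : (n.+2%:R : R) @[n --> \oo] --> +oo.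
  apply/cvgryPge => M; near=> n; rewrite (@le_trans _ _ n%:R) ?ler_nat//; last first.
    by rewrite -addn2 leq_addr.
  by near: n; exact: nbhs_infty_ger.
have invS : (n.+2%:R^-1 : R) @[n --> \oo] --> 0.
  have := @cvg_harmonic R; rewrite -cvg_shiftS; exact.
have F0 : (gamma_integrand (b + 1) n.+2%:R -
    gamma_integrand (b + 1) n.+2%:R^-1)%:E @[n --> \oo] --> 0%E.
  apply: cvg_EFin; first exact: nearW.
  rewrite -(subr0 0); apply: cvgB.
    exact: cvg_comp natS (gamma_integrand_cvgy b0).
  by have /cvg_at_rightP := gamma_integrand_cvg0 b0; apply; split.
have L := cvgeZl (erefl : b%:E \is a fin_num) (@gamma_integral_cvg b).
have Rr : (\int[mu]_(x in `[(n.+2%:R^-1)%R, (n.+2%:R)%R]) (gamma_integrand (b + 1) x)%:E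
   + (gamma_integrand (b + 1) n.+2%:R -
    gamma_integrand (b + 1) n.+2%:R^-1)%:E)%E @[n --> \oo] --> gamma_integral (b + 1).
  rewrite -[X in _ --> X]adde0; apply: cvgeD F0; last exact: gamma_integral_cvg.
  by rewrite fin_num_adde_defl.
apply: (cvg_unique _ Rr) => //; apply: cvg_trans L.
apply: near_eq_cvg; apply: nearW => n /=; apply: gamma_integral_by_parts => //.
by rewrite (@lt_trans _ _ 1) ?invf_lt1 ?ltr1n.
Unshelve. all: end_near. Qed.

(** For [0 < b <= 1] the integrand is unbounded at [0]; finiteness is pulled
back from [b + 1] by the functional equation. *)
Lemma gamma_integral_lty b : 0 < b -> (gamma_integral b < +oo)%E.
Proof.
move=> b0; have := gamma_integral_gt1_lty b0; rewrite gamma_integralD1//.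
by case: gamma_integral => [r _|/=|//]; rewrite ?ltry// gt0_muley ?lte_fin.
Qed.

(** A vanishing integral would make the positive integrand vanish almost
everywhere on a half-line of infinite measure. *)
Lemma gamma_integral_gt0 b : (0 < gamma_integral b)%E.
Proof.
have mg : measurable_fun [set: R] (fun x => (gamma_integrand b x)%:E).
  by apply/measurable_EFinP; exact: measurable_gamma_integrand.
have g0 x : (0 <= (gamma_integrand b x)%:E)%E by rewrite lee_fin gamma_integrand_ge0.
rewrite lt0e integral_ge0 ?andbT//; apply/eqP => gI0.
have : ae_eq mu `]0, +oo[%classic (EFin \o gamma_integrand b) (cst 0%E).
  apply/ae_eq_integral_abs => //; first exact: measurable_funTS.
  by rewrite -[RHS]gI0; apply: eq_integral => x _; rewrite gee0_abs//=; exact: g0.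
move=> [N [mN N0 sub]].
have : (mu `]0%R, +oo[%classic <= mu N)%E.
  apply: le_measure; rewrite ?inE// => x /= x0; apply: sub => /= /(_ x0).
  apply/eqP; rewrite eqe gt_eqF// mulr_gt0 ?expR_gt0// powR_gt0//.
  by move: x0; rewrite in_itv/= andbT.
by rewrite N0 lebesgue_measure_itv/= lt0y.
Qed.
End gamma_integral.

(** * Moments and orthogonality *)

Section laguerre_moments.
Context {R : realType} (a : R).
Hypothesis a_gtN1 : -1 < a.
Local Notation mu := (@lebesgue_measure R).
Local Notation nu := (laguerre_measure a).

(** Multiplying the weight by [x ^+ k] shifts the parameter of the Gamma
integrand by [k]. *)
Lemma exprn_laguerre_weight k x :
  (x ^+ k * laguerre_weight a x)%:E =
  ((EFin \o gamma_integrand (k%:R + (a + 1))) \_ `]0, +oo[) x.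
Proof.
rewrite /laguerre_weight !patchE; case: ifPn => [|_]; last by rewrite mulr0.
rewrite inE/= in_itv/= andbT => x0.
rewrite /gamma_integrand addrA addrK powRD ?(gt_eqF x0) ?implybT//.
by rewrite powR_mulrn ?(ltW x0)// -mulrA.
Qed.

Let ka0 k : 0 < k%:R + (a + 1).
Proof. by rewrite ltr_wpDl// -ltrBlDr sub0r. Qed.

Lemma integral_exprn_laguerre_weight k :
  (\int[mu]_x (x ^+ k * laguerre_weight a x)%:E =
   gamma_integral (k%:R + (a + 1)))%E.
Proof.
under eq_integral do rewrite exprn_laguerre_weight.
by rewrite -integral_mkcond.
Qed.

Lemma integrable_exprn_laguerre_weight k :
  mu.-integrable [set: R] (fun x => (x ^+ k * laguerre_weight a x)%:E).
Proof.
apply: (@eq_integrable _ _ _ mu _ measurableT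
  ((EFin \o gamma_integrand (k%:R + (a + 1))) \_ `]0, +oo[)).
  by move=> x _; rewrite exprn_laguerre_weight.
apply: (iffLR (integrable_mkcond _ _)) => //.
apply/integrableP; split.
  by apply/measurable_funTS/measurable_EFinP; exact: measurable_gamma_integrand.
under eq_integral do rewrite /= ger0_norm ?gamma_integrand_ge0//.
exact: gamma_integral_lty.
Qed.

Let iw : mu.-integrable [set: R] (EFin \o laguerre_weight a).
Proof.
have := integrable_exprn_laguerre_weight 0.
by apply: eq_integrable => // x _; rewrite expr0 mul1r.
Qed.

Let fin_nu : fin_num_fun nu.
Proof.
by move=> A mA; apply: integrable_fin_num => //; exact: integrableS iw.
Qed.

(* Finiteness depends on [-1 < a], which canonical inference cannot supply. *)
Let nu_fin : {finite_measure set (measurableTypeR R) -> \bar R} :=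
  HB.pack (laguerre_measure a) (Measure_isFinite.Build _ _ _ nu fin_nu).

Lemma integrable_exprn_laguerre k : nu.-integrable [set: R] (fun x => (x ^+ k)%:E).
Proof.
have w0 x : (0 <= (EFin \o laguerre_weight a) x)%E.
  by rewrite lee_fin laguerre_weight_ge0.
apply: (@integrable_density _ _ _ nu_fin mu _ iw _ w0) => //.
  by apply/measurable_EFinP; exact: exprn_measurable.
exact: integrable_exprn_laguerre_weight.
Qed.

Lemma integral_exprn_laguerre k :
  (\int[nu]_x (x ^+ k)%:E = gamma_integral (k%:R + (a + 1)))%E.
Proof.
have -> := @integral_density _ _ _ nu_fin mu _ iw _ _ (integrable_exprn_laguerre k).
  exact: integral_exprn_laguerre_weight.
by [].
Qed.

Lemma integrable_horner_laguerre (p : {poly R}) :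
  nu.-integrable [set: R] (fun x => p.[x]%:E).
Proof.
under [X in _.-integrable _ X]eq_fun do rewrite horner_coef -sumEFin.
apply: integrable_sum => // i _.
under [X in _.-integrable _ X]eq_fun do rewrite EFinM.
by apply: integrableZl => //; exact: integrable_exprn_laguerre.
Qed.

Definition laguerre_functional (p : {poly R}) : R := \int[nu]_x p.[x].

Lemma laguerre_functional_linear : scalar laguerre_functional.
Proof.
move=> c p q; rewrite /laguerre_functional.
under eq_Rintegral do rewrite hornerD hornerZ.
rewrite RintegralD//; last exact: integrable_horner_laguerre.
  rewrite RintegralZl//; exact: integrable_horner_laguerre.
under [X in _.-integrable _ X]eq_fun do rewrite /= EFinM.
by apply: integrableZl => //; exact: integrable_horner_laguerre.
Qed.

Lemma laguerre_functional_moment k :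
  laguerre_functional 'X^k = fine (gamma_integral (k%:R + (a + 1))).
Proof.
rewrite /laguerre_functional /Rintegral -integral_exprn_laguerre.
by under eq_integral do rewrite hornerXn.
Qed.

Lemma laguerre_functional_momentS k :
  laguerre_functional 'X^(k.+1) = (k%:R + a + 1) * laguerre_functional 'X^k.
Proof.
rewrite !laguerre_functional_moment -natr1 addrAC (gamma_integralD1 (ka0 k)).
have fin : gamma_integral (k%:R + (a + 1)) \is a fin_num.
  by rewrite ge0_fin_numE; [exact: gamma_integral_lty|exact/ltW/gamma_integral_gt0].
by rewrite fineM//= addrA.
Qed.

Lemma laguerre_functional1_gt0 : 0 < laguerre_functional 1.
Proof.
have -> : (1 : {poly R}) = 'X^0 by rewrite expr0.
rewrite laguerre_functional_moment fine_gt0//.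
by rewrite gamma_integral_gt0 (gamma_integral_lty (ka0 0)).
Qed.

Lemma integral_horner_laguerre (p : {poly R}) :
  (\int[nu]_x p.[x]%:E = (laguerre_functional p)%:E)%E.
Proof.
rewrite /laguerre_functional /Rintegral fineK//.
apply: integrable_fin_num => //; exact: integrable_horner_laguerre.
Qed.

Lemma laguerre_orthogonal : orthogonal_polys 0 (laguerre a) nu.
Proof.
pose L : {scalar {poly R}} := HB.pack laguerre_functional
  (GRing.isLinear.Build _ _ _ _ laguerre_functional laguerre_functional_linear).
have LS k : L 'X^(k.+1) = (k%:R + a + 1) * L 'X^k by exact: laguerre_functional_momentS.
move=> n m _ _; under [X in _.-integrable _ X]eq_fun do rewrite -hornerM.
under [X in _ -> X = _]eq_integral do rewrite -hornerM.
under [X in _ -> X <> _]eq_integral do rewrite -hornerM.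
rewrite !integral_horner_laguerre; split.
- exact: integrable_horner_laguerre.
- move=> /eqP; rewrite neq_ltn => /orP[nm|mn]; congr EFin.
    by rewrite mulrC; exact: (moment_laguerre_lt LS nm).
  exact: (moment_laguerre_lt LS mn).
- move=> <- [/eqP]; apply/negP; rewrite gt_eqF//.
  have -> : laguerre_functional (laguerre a n * laguerre a n) =
      laguerre_functional 1 * \prod_(k < n) (k.+1%:R * (k.+1%:R + a)).
    exact: (moment_laguerre_sqr LS).
  rewrite mulr_gt0 ?laguerre_functional1_gt0// prodr_gt0// => i _.
  by rewrite mulr_gt0// -natr1 -addrA [1 + a]addrC ka0.
Qed.

End laguerre_moments.

Theorem mainTheorem5 (R : realType) (alpha : R) (gamma : nat -> R)
    (halpha : -1 < alpha)
    (hgamma : forall n : nat, (1 <= n)%N -> gamma n = n%:R) :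
  [/\ forall j : nat, (2 <= j)%N ->
        (2 + gamma j - gamma j.+1)
          + (gamma j.-1)^-1 * ((j%:R - 1) * (j%:R + alpha))
          - (gamma j)^-1 * (j%:R * (j%:R + alpha + 1)) = 0,
      forall n : nat, (1 <= n)%N ->
        qc_laguerre alpha n = laguerre alpha n,
      orthogonal_polys 0 (qc_laguerre alpha) (laguerre_measure alpha)
    & forall n : nat, (1 <= n)%N ->
        qc_laguerre alpha n.+1 =
          ('X - (2 * n%:R + alpha + 1)%:P) * qc_laguerre alpha n
            - (n%:R * (n%:R + alpha)) *: qc_laguerre alpha n.-1].
Proof.
have qcE : qc_laguerre alpha = laguerre alpha.
  by apply/funext => -[|n] //; rewrite [RHS]laguerre_parameter_shift.
split.
- case=> [|[|j]] // _; rewrite !hgamma//=.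
  have j1 : j.+1%:R != 0 :> R by rewrite pnatr_eq0.
  have j2 : j.+1%:R + 1 != 0 :> R by rewrite natr1 pnatr_eq0.
  rewrite -[j.+3%:R]natr1 -[j.+2%:R]natr1; move: j.+1%:R j1 j2 => x x0 x1.
  by field; rewrite x0 x1.
- by move=> n _; rewrite qcE.
- by rewrite qcE; exact: laguerre_orthogonal.
- by rewrite qcE => -[|n] // _; exact: laguerre_rec.
Qed.
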